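(* Given a finite field $\mathbb F_q$ with $q$ elements, the number of right ideals having codimension $n$ of the $\mathbb F_q$-algebra $\mathbb F_q\langle a,b,a^{-1},b^{-1}\rangle$ of noncommutative Laurent polynomials in two free noncommuting generators $a,b$ is equal to $$(q-1)^{n+1}\, q^{\frac{(n+1)(n-2)}{2}}\sum_{\theta\in \mathrm{Indec}_{n+1}} q^{\mathrm{inv}(\theta)},$$ where $\mathrm{Indec}_{n+1}$ denotes the subset of all indecomposable permutations in $S_{n+1}$. Equivalently, this number is also given by $$\left(\frac{q-1}{q}\right)^{n+1}\sum_{\theta\in \mathrm{Indec}_{n+1}} q^{p(\theta)},$$ where $p(\theta)$ is equal to the cardinality of the set $\{(i,j) : 1\leq i,j\leq n+1,\ j<\theta(i)\text{ or } i>\theta^{-1}(j)\}$.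
   Context: $S_m$ is the group of permutations of $\{1,\dots,m\}$. A permutation $\sigma\in S_m$ is decomposable if $\sigma(\{1,\dots,i\})=\{1,\dots,i\}$ for some $i\in\{1,\dots,m-1\}$, and indecomposable otherwise. An inversion of $\sigma\in S_m$ is a pair of integers $i,j$ with $1\le i<j\le m$ and $\sigma(i)>\sigma(j)$; $\mathrm{inv}(\sigma)$ is the number of inversions of $\sigma$. The algebra $K\langle a,b,a^{-1},b^{-1}\rangle$ of noncommutative Laurent polynomials over a field $K$ is the group algebra over $K$ of the free group generated by $a,b$. The codimension of a right ideal $I$ in a $K$-algebra $R$ is the dimension of the quotient of $R$ by $I$ as a $K$-vector space.
   Formalization: The codimension n is assumed to be at least 1; for n = 0 there is exactly one right ideal (the whole algebra), while both formulas give (q-1)/q, so the claim fails there. *)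

(* Defs.v *)
From HB Require Import structures.
From mathcomp Require Import all_boot all_order all_fingroup all_algebra.
From mathcomp Require Import finmap.
From mathcomp Require Import boolp classical_sets functions cardinality.
From mathcomp.multinomials Require Import monalg.

Set Implicit Arguments.
Unset Strict Implicit.
Unset Printing Implicit Defensive.

Import GRing.Theory.

Local Open Scope ring_scope.

(* The letter (x, false) is the generator x, and (x, true) its inverse. *)
Section FreeGroup.
Variable X : choiceType.
Implicit Types (x y : X * bool) (u v w : seq (X * bool)).

Definition invl x : X * bool := (x.1, ~~ x.2).

Definition reduced w := sorted (fun x y => y != invl x) w.

Definition pushl x w := if w is y :: w' then
  if y == invl x then w' else x :: w else [:: x].

Definition reduce w := foldr pushl [::] w.

Definition invw w := rev (map invl w).

Lemma invlK : involutive invl.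
Proof. by case=> x b; rewrite /invl /= negbK. Qed.

Lemma reduced_pushl x w : reduced w -> reduced (pushl x w).
Proof.
case: w => [//|y w] /= yw; case: ifP => [_|/negbT yx]; first exact: path_sorted yw.
by rewrite /= yx.
Qed.

Lemma reduced_reduce w : reduced (reduce w).
Proof. by elim: w => //= x w; apply: reduced_pushl. Qed.

Lemma reduce_id w : reduced w -> reduce w = w.
Proof.
elim: w => //= x w IHw xw; rewrite IHw; last exact: path_sorted xw.
by case: w xw {IHw} => //= y w /andP[/negPf->].
Qed.

Lemma pushlK x w : reduced w -> pushl (invl x) (pushl x w) = w.
Proof.
case: w => [|y w] /= rw; first by rewrite invlK eqxx.
have [yx|yx] := eqVneq y (invl x); last by rewrite /= invlK eqxx.
by case: w rw => [|z w] /=; rewrite -yx // => /andP[/negPf->].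
Qed.

Lemma reduce_catr u v : reduce (u ++ reduce v) = reduce (u ++ v).
Proof. by elim: u => [|x u /= -> //]; rewrite /= reduce_id ?reduced_reduce. Qed.

Lemma reduce_pushl x u v : reduce (pushl x u ++ v) = pushl x (reduce (u ++ v)).
Proof.
case: u => [//|y u] /=; case: eqP => [->|//].
by have := pushlK (invl x) (reduced_reduce (u ++ v)); rewrite invlK.
Qed.

Lemma reduce_catl u v : reduce (reduce u ++ v) = reduce (u ++ v).
Proof. by elim: u => //= x u IHu; rewrite reduce_pushl IHu. Qed.

Lemma reduce_invwl w : reduce (invw w ++ w) = [::].
Proof.
elim: w => //= x w IHw; rewrite /invw map_cons rev_cons cat_rcons.
rewrite -(reduce_catr (invw w)).
have -> : reduce [:: invl x, x & w] = reduce w by apply/pushlK/reduced_reduce.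
by rewrite reduce_catr.
Qed.

Lemma invwK : involutive invw.
Proof.
by move=> w; rewrite /invw map_rev revK -map_comp map_id_in // => x _; apply: invlK.
Qed.

Lemma reduce_invwr w : reduce (w ++ invw w) = [::].
Proof. by rewrite -{1}[w]invwK reduce_invwl. Qed.

Record free_group := FreeGroup {
  word :> seq (X * bool);
  word_reduced : reduced word }.

HB.instance Definition _ := [isSub for word].
HB.instance Definition _ := [Choice of free_group by <:].

Definition freeg_of w := FreeGroup (reduced_reduce w).
Definition freeg1 := freeg_of [::].
Definition freegM (g h : free_group) := freeg_of (word g ++ word h).
Definition freegV (g : free_group) := freeg_of (invw (word g)).

Fact freegMA : associative freegM.
Proof. by move=> f g h; apply: val_inj; rewrite /= reduce_catl reduce_catr catA. Qed.

Fact freeg1M : left_id freeg1 freegM.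
Proof. by move=> g; apply: val_inj; rewrite /= reduce_id ?word_reduced. Qed.

Fact freegM1 : right_id freeg1 freegM.
Proof. by move=> g; apply: val_inj; rewrite /= cats0 reduce_id ?word_reduced. Qed.

Fact freegVM : left_inverse freeg1 freegV freegM.
Proof. by move=> g; apply: val_inj; rewrite /= reduce_catl reduce_invwl. Qed.

Fact freegMV : right_inverse freeg1 freegV freegM.
Proof. by move=> g; apply: val_inj; rewrite /= reduce_catr reduce_invwr. Qed.

HB.instance Definition _ :=
  isGroup.Build free_group freegMA freeg1M freegM1 freegVM freegMV.

End FreeGroup.

(* {malg K[G]} only carries a product when G has no nontrivial invertible
   element, so the convolution product is defined here on a copy of it. *)
Definition group_algebra (K : nzRingType) (G : groupType) : Type := {malg K[G]}.

Section GroupAlgebraRing.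
Variables (K : nzRingType) (G : groupType).
Implicit Types (g h : {malg K[G]}) (k l : G).

HB.instance Definition _ := GRing.Lmodule.copy (group_algebra K G) {malg K[G]}.

Definition gamul g h : {malg K[G]} :=
  \sum_(k <- msupp g) \sum_(l <- msupp h) << g@_k * h@_l *g (k * l)%g >>.

Definition gaone : {malg K[G]} := << 1 *g 1%g >>.

Local Open Scope fset_scope.

Lemma gamulw (d1 d2 : {fset G}) g h : msupp g `<=` d1 -> msupp h `<=` d2 ->
  gamul g h = \sum_(k <- d1) \sum_(l <- d2) << g@_k * h@_l *g (k * l)%g >>.
Proof.
move=> le_d1 le_d2; rewrite /gamul (big_fset_incl _ le_d1) /=.
  apply/eq_bigr=> k _; apply/big_fset_incl => // l _ /mcoeff_outdom ->.
  by rewrite mulr0 monalgU0.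
move=> k _ /mcoeff_outdom g1k.
by rewrite big1 => // l _; rewrite g1k mul0r monalgU0.
Qed.

Lemma gamul0g : left_zero 0 gamul.
Proof. by move=> g; rewrite /gamul msupp0 big_seq_fset0. Qed.

Lemma gamulg0 : right_zero 0 gamul.
Proof. by move=> g; rewrite /gamul msupp0 big1 // => k _; rewrite big_seq_fset0. Qed.

Lemma gamulUU a b k l :
  gamul << a *g k >> << b *g l >> = << a * b *g (k * l)%g >>.
Proof. by rewrite (gamulw msuppU_le msuppU_le) !big_seq_fset1 !mcoeffUU. Qed.

Lemma gamulDl : left_distributive gamul +%R.
Proof.
move=> f g h.
rewrite (gamulw (msuppD_le f g) (fsubset_refl _)).
rewrite (gamulw (fsubsetUl (msupp f) (msupp g)) (fsubset_refl _)).
rewrite (gamulw (fsubsetUr (msupp f) (msupp g)) (fsubset_refl _)).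
rewrite -big_split /=; apply/eq_bigr=> k _.
rewrite -big_split /=; apply/eq_bigr=> l _.
by rewrite mcoeffD mulrDl monalgUD.
Qed.

Lemma gamulDr : right_distributive gamul +%R.
Proof.
move=> f g h.
rewrite (gamulw (fsubset_refl _) (msuppD_le g h)).
rewrite (gamulw (fsubset_refl _) (fsubsetUl (msupp g) (msupp h))).
rewrite (gamulw (fsubset_refl _) (fsubsetUr (msupp g) (msupp h))).
rewrite -big_split /=; apply/eq_bigr=> k _.
rewrite -big_split /=; apply/eq_bigr=> l _.
by rewrite mcoeffD mulrDr monalgUD.
Qed.

Lemma gamul_suml (I : Type) (r : seq I) (F : I -> {malg K[G]}) h :
  gamul (\sum_(i <- r) F i) h = \sum_(i <- r) gamul (F i) h.
Proof.
exact: (big_morph (gamul^~ h) (fun _ _ => gamulDl _ _ _) (gamul0g _)).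
Qed.

Lemma gamul_sumr (I : Type) (r : seq I) (F : I -> {malg K[G]}) g :
  gamul g (\sum_(i <- r) F i) = \sum_(i <- r) gamul g (F i).
Proof.
exact: (big_morph (gamul g) (fun _ _ => gamulDr _ _ _) (gamulg0 _)).
Qed.

Lemma gamul1g : left_id gaone gamul.
Proof.
move=> g; rewrite [in LHS](monalgE g) [in RHS](monalgE g) gamul_sumr.
by apply/eq_bigr => k _; rewrite gamulUU mul1r mul1g.
Qed.

Lemma gamulg1 : right_id gaone gamul.
Proof.
move=> g; rewrite [in LHS](monalgE g) [in RHS](monalgE g) gamul_suml.
by apply/eq_bigr => k _; rewrite gamulUU mulr1 mulg1.
Qed.

Lemma gamulA : associative gamul.
Proof.
move=> f g h; rewrite (monalgE f) (monalgE g) (monalgE h).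
rewrite !gamul_suml; apply/eq_bigr => i _.
rewrite [in LHS]gamul_sumr [gamul << _ *g i >> _]gamul_sumr gamul_suml.
apply/eq_bigr => j _.
rewrite !gamul_sumr; apply/eq_bigr => k _.
by rewrite !gamulUU mulrA mulgA.
Qed.

Lemma gaone_neq0 : gaone != 0.
Proof. by rewrite monalgU_eq0 oner_eq0. Qed.

HB.instance Definition _ := GRing.Zmodule_isNzRing.Build (group_algebra K G)
  gamulA gamul1g gamulg1 gamulDl gamulDr gaone_neq0.

Lemma gaZE a k l b : a *: (<< b *g k >> : {malg K[G]}) = << a * b *g k >>.
Proof. by apply/malgP => i; rewrite mcoeffZ !mcoeffU mulrnAr. Qed.

Lemma gascaleAl (a : K) (g h : group_algebra K G) : a *: (g * h) = a *: g * h.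
Proof.
change (a *: gamul g h = gamul (a *: (g : {malg K[G]})) h).
rewrite (monalgE g) (monalgE h) gamul_suml !scaler_sumr gamul_suml.
apply/eq_bigr => k _; rewrite !gamul_sumr scaler_sumr.
by apply/eq_bigr => l _; rewrite gamulUU !gaZE // gamulUU mulrA.
Qed.

HB.instance Definition _ :=
  GRing.Lmodule_isLalgebra.Build K (group_algebra K G) gascaleAl.

End GroupAlgebraRing.

Section GroupAlgebraAlgebra.
Variables (K : comNzRingType) (G : groupType).

Lemma gascaleAr (a : K) (g h : group_algebra K G) : a *: (g * h) = g * (a *: h).
Proof.
change (a *: gamul g h = gamul g (a *: (h : {malg K[G]}))).
rewrite (monalgE g) (monalgE h) gamul_suml !scaler_sumr gamul_suml.
apply/eq_bigr => k _; rewrite !gamul_sumr scaler_sumr.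
by apply/eq_bigr => l _; rewrite gamulUU !gaZE // gamulUU mulrCA.
Qed.

HB.instance Definition _ :=
  GRing.Lalgebra_isAlgebra.Build K (group_algebra K G) gascaleAr.

End GroupAlgebraAlgebra.

(* The algebra of noncommutative Laurent polynomials in two generators. *)
Definition laurent2 (K : comNzRingType) : algType K :=
  group_algebra K (free_group 'I_2).

(* submodClosed does not inherit from zmodClosed, on which the library quotients
   of additive groups rely; submod_pred S is S seen as a zmodClosed. *)
Section QuotientModule.
Variables (K : fieldType) (V : lmodType K) (S : submodClosed V).
Local Open Scope quotient_scope.

Definition submod_pred : {pred V} := fun v => v \in S.

Fact submod_pred_zmod : zmod_closed submod_pred.
Proof. exact: GRing.submod_closedB (submodClosedP S). Qed.

HB.instance Definition _ := GRing.isZmodClosed.Build V submod_pred submod_pred_zmod.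

Definition quotmod : Type := Quotient.quot submod_pred.

HB.instance Definition _ := GRing.Zmodule.copy quotmod (Quotient.quot submod_pred).

Let Q : zmodType := Quotient.quot submod_pred.
Let proj (v : V) : Q := \pi_(Quotient.quot submod_pred) v.

Definition quot_scale (a : K) (u : Q) : Q := proj (a *: generic_quotient.repr u).

Let projD : {morph proj : u v / u + v >-> u + v}.
Proof. exact: raddfD. Qed.

Let projK u : proj (generic_quotient.repr u) = u.
Proof. exact: reprK. Qed.

Let proj_scale a v : quot_scale a (proj v) = proj (a *: v).
Proof.
apply/eqP; rewrite /quot_scale /proj -Quotient.idealrBE -scalerBr; apply: rpredZ.
by rewrite -[_ \in S]/(_ \in submod_pred) Quotient.idealrBE reprK.
Qed.

Fact quot_scaleA a b u : quot_scale a (quot_scale b u) = quot_scale (a * b) u.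
Proof. by rewrite -(projK u) !proj_scale scalerA. Qed.

Fact quot_scale1 : left_id 1 quot_scale.
Proof. by move=> u; rewrite -(projK u) proj_scale scale1r. Qed.

Fact quot_scaleDr : right_distributive quot_scale +%R.
Proof.
move=> a u v; rewrite -(projK u) -(projK v) -projD !proj_scale scalerDr.
exact: projD.
Qed.

Fact quot_scaleDl u : {morph quot_scale^~ u : a b / a + b}.
Proof. by move=> a b /=; rewrite -(projK u) !proj_scale scalerDl projD. Qed.

HB.instance Definition _ := GRing.Zmodule_isLmodule.Build K quotmod
  quot_scaleA quot_scale1 quot_scaleDr quot_scaleDl.

End QuotientModule.

Definition right_ideal (R : pzRingType) (I : set R) : Prop :=
  [/\ I 0, forall x y, I x -> I y -> I (x + y) & forall x y, I x -> I (x * y)].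

(* A right ideal is a linear subspace, since a *: x = x * a%:A; hence for right
   ideals the existence of S with carrier I is no restriction. *)
Definition has_codim (K : fieldType) (V : lmodType K) (I : set V) (n : nat) : Prop :=
  exists2 S : submodClosed V,
    I = [set x | x \in S]%classic & inhabited (Vector.axiom n (quotmod S)).

Definition right_ideals_codim (K : fieldType) (R : algType K) (n : nat) :
    set (set R) :=
  [set I | right_ideal I /\ has_codim I n]%classic.
Arguments right_ideals_codim {K} R n.

(* {1, ..., m} is 'I_m = {0, ..., m - 1}: {1, ..., i} becomes {j | j < i}. *)
Section Permutations.
Variable m : nat.
Implicit Type s : 'S_m.

Definition decomposable s : bool :=
  [exists i : 'I_m, (0 < i)%N &&
     (s @: [set j : 'I_m | (j < i)%N] == [set j : 'I_m | (j < i)%N])].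

Definition Indec : {set 'S_m} := [set s | ~~ decomposable s].

Definition inversions s : nat :=
  #|[set ij : 'I_m * 'I_m | (ij.1 < ij.2)%N && (s ij.2 < s ij.1)%N]|.

Definition pstat s : nat :=
  #|[set ij : 'I_m * 'I_m | (ij.2 < s ij.1)%N || ((s^-1)%g ij.2 < ij.1)%N]|.

End Permutations.

(* Main.v *)
(* A right ideal of codimension n is the annihilator of a cyclic vector v in a
   right module of dimension n, i.e. it is given by a triple (A, B, v) with A, B
   in GL_n and v generating F_q^n under A and B, up to the free action of GL_n by
   change of basis. Let N_n be the number of these orbits. Sorting all triples
   (A, B, v) with A, B invertible by the dimension k of the submodule that v
   generates yields
     sum_(k <= n) N_k |GL_(n-k)| q^(k(n-k)) = |GL_n| q^n.
   Let S_m and I_m be the generating functions of inv over S_m and Indec_m.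
   Splitting off the first indecomposable block of a permutation gives
     S_(n+1) = sum_(k <= n) I_(k+1) S_(n-k),
   and |GL_n| = (q-1)^n q^(n(n-1)/2) S_n. Hence q N_k and
   (q-1)^(k+1) q^(k(k-1)/2) I_(k+1) satisfy recurrences that differ only in the
   term k = 0, and they agree for k >= 1. *)
From HB Require Import structures.
Require Import Defs.
From mathcomp Require Import finmap boolp classical_sets functions cardinality.
From mathcomp.multinomials Require Import monalg.
From mathcomp Require Import all_boot all_order all_fingroup all_algebra ring.

Set Implicit Arguments.
Unset Strict Implicit.
Unset Printing Implicit Defensive.

Import GRing.Theory Num.Theory.
Local Open Scope ring_scope.

(** * Inversions and indecomposable blocks *)

Section Inversions.
Local Open Scope nat_scope.

Lemma inversions_sumE m (s : 'S_m) :
  inversions s = \sum_(i < m) \sum_(j < m) ((i < j) && (s j < s i)).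
Proof.
rewrite /inversions cardsE -sum1_card big_mkcond pair_big /=.
by apply: eq_bigr => -[i j] _ /=; rewrite unfold_in /=; case: (_ && _).
Qed.

Lemma sum_ltn_ord m j : j <= m -> \sum_(i < m) (i < j) = j.
Proof.
move=> jm; rewrite -(big_mkord xpredT (fun i => nat_of_bool (i < j))).
rewrite (@big_cat_nat _ _ _ j) //= big_nat (eq_bigr (fun=> 1)) => [|i /andP[_ ->]] //.
rewrite -big_nat sum_nat_const_nat subn0 muln1 big_nat big1 ?addn0 // => i /andP[ji _].
by rewrite ltnNge ji.
Qed.

(** The value [j] at position 0 forms an inversion with exactly the [j] positions of smaller value.
    Lifting is increasing, so all other pairs invert as in [s]. *)
Lemma inversions_lift_perm m (j : 'I_m.+1) (s : 'S_m) :
  inversions (lift_perm ord0 j s) = j + inversions s.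
Proof.
have ltb (a b : 'I_m) : (lift j a < lift j b) = (a < b).
  by rewrite !ltnNge leq_bump2.
rewrite !inversions_sumE big_ord_recl; congr addn.
  rewrite big_ord_recl ltnn add0n lift_perm_id.
  under eq_bigr => i _ do rewrite lift_perm_lift.
  rewrite -{2}(@sum_ltn_ord m j) -1?ltnS // [RHS](reindex_inj (@perm_inj _ s)) /=.
  apply: eq_bigr => i _; congr nat_of_bool; rewrite /bump.
  by case: (leqP j (s i)) => [jle|->] //; rewrite add1n ltnNge leqW.
apply: eq_bigr => i _; rewrite big_ord_recl add0n.
by apply: eq_bigr => k _; rewrite !lift_perm_lift ltb /= /bump !add1n ltnS.
Qed.

(** With [j = s k] the condition on (i, j) reads s k < s i or k < i. All C(m, 2) pairs with k < i
    satisfy it, those with i < k do so exactly at inversions, and k = i never does. *)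
Lemma pstatE m (s : 'S_m) : pstat s = 'C(m, 2) + inversions s.
Proof.
have -> : pstat s = \sum_(i < m) \sum_(k < m) ((s k < s i) || (k < i)).
  rewrite /pstat cardsE -sum1_card big_mkcond.
  rewrite (reindex (fun ik : 'I_m * 'I_m => (ik.1, s ik.2))) /=; last first.
    exists (fun ij => (ij.1, s^-1 ij.2)%g) => -[i j] _ /=; first by rewrite permK.
    by rewrite permKV.
  rewrite pair_big /=; apply: eq_bigr => -[i j] _.
  by rewrite unfold_in /= permK; case: (_ || _).
rewrite inversions_sumE -bin2_sum big_mkord -big_split /=.
apply: eq_bigr => i _; rewrite -{2}(sum_ltn_ord (ltnW (ltn_ord i))) -big_split /=.
apply: eq_bigr => k _; case: (ltngtP k i) => [||/val_inj ->] /=.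
- by rewrite orbT.
- by rewrite orbF.
- by rewrite ltnn.
Qed.

End Inversions.

(** * Direct sums of permutations and the first indecomposable block *)

Section Blocks.
Local Open Scope nat_scope.

Definition stab m (s : 'S_m) i := [forall j : 'I_m, (j < i) ==> (s j < i)].

Lemma stabP m (s : 'S_m) i : reflect (forall j : 'I_m, j < i -> s j < i) (stab s i).
Proof. by apply: (iffP forallP) => H j; apply/implyP/H. Qed.

(** An injective image keeps its cardinality, so the inclusion of the image in the initial segment
    is an equality. *)
Lemma stab_imset m (s : 'S_m) i :
  stab s i = (s @: [set j : 'I_m | j < i] == [set j : 'I_m | j < i]).
Proof.
apply/stabP/eqP => [H|H j ji]; last first.
  have : s j \in s @: [set j : 'I_m | j < i] by rewrite imset_f ?inE.
  by rewrite H inE.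
apply/eqP; rewrite eqEcard card_imset ?leqnn ?andbT; last exact: perm_inj.
by apply/subsetP=> _ /imsetP[j + ->]; rewrite !inE; apply: H.
Qed.

Lemma stab_ltn m (s : 'S_m) i : stab s i -> forall j : 'I_m, (s j < i) = (j < i).
Proof.
rewrite stab_imset => /eqP H j.
have : (s j \in s @: [set j : 'I_m | j < i]) = (j < i).
  by rewrite mem_imset ?inE //; apply: perm_inj.
by rewrite H inE.
Qed.

(* For 0 < k: k is the length of the first indecomposable block of s. *)
Definition first_block k m (s : 'S_m) :=
  stab s k && [forall i : 'I_k, (0 < i) ==> ~~ stab s i].

Lemma decomposableE m (s : 'S_m) :
  ~~ decomposable s = [forall i : 'I_m, (0 < i) ==> ~~ stab s i].
Proof.
rewrite /decomposable negb_exists; apply: eq_forallb => i.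
by rewrite stab_imset negb_and; case: (0 < i).
Qed.

Section DirectSum.
Variables k l : nat.

Definition dsum_fun (s1 : 'S_k) (s2 : 'S_l) (i : 'I_(k + l)) : 'I_(k + l) :=
  match split i with inl a => lshift l (s1 a) | inr b => rshift k (s2 b) end.

Lemma dsum_funK s1 s2 : cancel (dsum_fun s1 s2) (dsum_fun s1^-1 s2^-1).
Proof.
move=> i; rewrite /dsum_fun; case: (splitP i) => [a ia|b ib].
  rewrite (unsplitK (inl _)) permK; exact/val_inj.
rewrite (unsplitK (inr _)) permK; exact/val_inj.
Qed.

Definition dsum s1 s2 : 'S_(k + l) := perm (can_inj (dsum_funK s1 s2)).

Lemma dsum_lshift s1 s2 a : dsum s1 s2 (lshift l a) = lshift l (s1 a).
Proof. by rewrite permE /dsum_fun (unsplitK (inl _)). Qed.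

Lemma dsum_rshift s1 s2 b : dsum s1 s2 (rshift k b) = rshift k (s2 b).
Proof. by rewrite permE /dsum_fun (unsplitK (inr _)). Qed.

Lemma dsum_inj : injective (fun s : 'S_k * 'S_l => dsum s.1 s.2).
Proof.
move=> [s1 s2] [t1 t2] /= E; congr pair; apply/permP => a.
  by apply: (@lshift_inj _ l); rewrite -(dsum_lshift s1 s2) -(dsum_lshift t1 t2) E.
by apply: (@rshift_inj k); rewrite -(dsum_rshift s1 s2) -(dsum_rshift t1 t2) E.
Qed.

(** Values on the first block lie below those on the second, so no inversion joins the two
    blocks. *)
Lemma inversions_dsum s1 s2 : inversions (dsum s1 s2) = inversions s1 + inversions s2.
Proof.
rewrite !inversions_sumE big_split_ord /=; congr addn; apply: eq_bigr => a _.
  rewrite big_split_ord /= [X in _ + X]big1 ?addn0.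
    by apply: eq_bigr => b _; rewrite !dsum_lshift.
  move=> b _; rewrite dsum_lshift dsum_rshift /=.
  by rewrite [_ + _ < _]ltnNge (leq_trans (ltnW (ltn_ord _))) ?leq_addr ?andbF.
rewrite big_split_ord /= big1 ?add0n.
  by apply: eq_bigr => b _; rewrite !dsum_rshift /= !ltn_add2l.
move=> b _; rewrite ltnNge (leq_trans (ltnW (ltn_ord _))) ?leq_addr //.
Qed.

Lemma stab_dsum s1 s2 i : i <= k -> stab (dsum s1 s2) i = stab s1 i.
Proof.
move=> ik; apply/stabP/stabP => H j ji.
  by have := H (lshift l j) ji; rewrite dsum_lshift.
case: (splitP j) ji => [a ja|b jb]; last first.
  by rewrite jb ltnNge (leq_trans ik) ?leq_addr.
by rewrite ja; have -> : j = lshift l a; [exact: val_inj|rewrite dsum_lshift; apply: H].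
Qed.

(** By [stab_ltn] the last [l] indices are stable too; both restrictions are injective, hence
    permutations. *)
Lemma stab_dsum_ex (s : 'S_(k + l)) : stab s k -> exists st, s = dsum st.1 st.2.
Proof.
move=> /stab_ltn H.
have H1 a : {b | s (lshift l a) = lshift l b}.
  have lt : s (lshift l a) < k by rewrite H /=.
  by exists (Ordinal lt); apply: val_inj.
have H2 a : {b | s (rshift k a) = rshift k b}.
  case: (splitP (s (rshift k a))) => [b E|b E]; last by exists b; apply: val_inj.
  by exfalso; have := H (rshift k a); rewrite E ltn_ord /= ltnNge leq_addr.
have i1 : injective (fun a => sval (H1 a)).
  move=> a b E; apply: (@lshift_inj _ l); apply: (@perm_inj _ s).
  by rewrite (svalP (H1 a)) (svalP (H1 b)) E.
have i2 : injective (fun a => sval (H2 a)).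
  move=> a b E; apply: (@rshift_inj k); apply: (@perm_inj _ s).
  by rewrite (svalP (H2 a)) (svalP (H2 b)) E.
exists (perm i1, perm i2); apply/permP => j; case: (splitP j) => [a|a] E.
  have -> : j = lshift l a by exact: val_inj.
  by rewrite dsum_lshift permE; exact: (svalP (H1 a)).
have -> : j = rshift k a by exact: val_inj.
by rewrite dsum_rshift permE; exact: (svalP (H2 a)).
Qed.

(** The sum always stabilizes the first [k] indices, and below [k] stability depends on [s1]
    alone. *)
Lemma first_block_dsum s1 s2 : first_block k (dsum s1 s2) = (s1 \in Indec k).
Proof.
rewrite /first_block inE decomposableE stab_dsum // [X in X && _](_ : _ = true).
  by apply: eq_forallb => i; rewrite stab_dsum // ltnW.
by apply/stabP => j _; apply: ltn_ord.
Qed.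

Lemma first_block_imset :
  [set s : 'S_(k + l) | first_block k s] =
    [set dsum s.1 s.2 | s in setX (Indec k) [set: 'S_l]].
Proof.
apply/setP => s; rewrite inE; apply/idP/imsetP => [bs|[[s1 s2] + ->]].
  have /andP[/stab_dsum_ex[[s1 s2] E] _] := bs.
  by exists (s1, s2); rewrite // in_setX in_setT andbT -(first_block_dsum s1 s2) -E.
by rewrite in_setX in_setT andbT first_block_dsum.
Qed.

End DirectSum.

End Blocks.

(** * Generating functions of inversions *)

Section GeneratingFunctions.
Variables (R : comNzRingType) (q : R).

Definition inv_gf m : R := \sum_(s : 'S_m) q ^+ inversions s.

Definition indec_gf m : R := \sum_(s in Indec m) q ^+ inversions s.

Lemma inv_gf0 : inv_gf 0 = 1.
Proof.
rewrite /inv_gf (big_pred1 1%g) => [|s].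
  by rewrite inversions_sumE big_ord0.
by apply/esym/eqP/permP => -[].
Qed.

(** A permutation of [m.+1] points amounts to its value [j] at 0 and a permutation of the rest; the
    value accounts for [j] inversions. *)
Lemma inv_gfS m : inv_gf m.+1 = (\sum_(j < m.+1) q ^+ j) * inv_gf m.
Proof.
rewrite /inv_gf (reindex (fun js : 'I_m.+1 * 'S_m => lift_perm ord0 js.1 js.2)) /=.
  rewrite mulr_suml -(pair_bigA _ (fun j s => q ^+ inversions (lift_perm ord0 j s))).
  apply: eq_bigr => j _; rewrite mulr_sumr; apply: eq_bigr => s _.
  by rewrite inversions_lift_perm exprD.
apply: onW_bij; apply: inj_card_bij.
  move=> [j s] [i t] /= E.
  have ji : j = i by rewrite -(lift_perm_id ord0 j s) E lift_perm_id.
  rewrite {}ji in E *; congr pair; apply/permP => a; apply: (@lift_inj _ i).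
  by rewrite -!(lift_perm_lift ord0) E.
by rewrite card_prod !card_Sn card_ord.
Qed.

Lemma sum_first_block k l :
  \sum_(s : 'S_(k + l) | first_block k s) q ^+ inversions s = indec_gf k * inv_gf l.
Proof.
rewrite -big_set first_block_imset big_imset /=; last by move=> s t _ _ /dsum_inj.
rewrite /indec_gf mulr_suml.
under [RHS]eq_bigr => s _ do rewrite mulr_sumr.
rewrite pair_big_dep /=; apply: eq_big => [[s1 s2]|[s1 s2] _] /=.
  by rewrite in_setX in_setT.
by rewrite inversions_dsum exprD.
Qed.

(** Permutations are sorted by the length [k.+1] of their first indecomposable block; the remaining
    [m - k] points are permuted freely. *)
Lemma inv_gf_indec m :
  inv_gf m.+1 = \sum_(k < m.+1) indec_gf k.+1 * inv_gf (m - k).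
Proof.
have stm (s : 'S_m.+1) : stab s (@ord_max m).+1 by apply/stabP=> j _; apply: ltn_ord.
(* [f s] is one less than the length of the first block; [ord_max] is always a candidate for the
   minimum. *)
pose f (s : 'S_m.+1) := [arg min_(i < @ord_max m | stab s i.+1) i].
rewrite /inv_gf (partition_big f xpredT) //=; apply: eq_bigr => k _.
have km : (k.+1 + (m - k) = m.+1)%N by rewrite addSn subnKC // -ltnS.
rewrite -(sum_first_block k.+1 (m - k)) km; apply: eq_bigl => s.
rewrite /f; case: arg_minnP; first exact: stm.
move=> i si mini; apply/eqP/andP => [<-|[sk /forallP nsk]].
  split=> //; apply/forallP => -[[|j] ji] //=; apply/negP => sj.
  have jm : (j < m.+1)%N by rewrite (leq_trans _ (ltn_ord i)) // ltnW.
  by have := mini (Ordinal jm) sj; rewrite /= leqNgt -ltnS ji.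
apply/val_inj/eqP; rewrite eqn_leq mini // leqNgt; apply/negP => ik.
have iS : (i.+1 < k.+1)%N by rewrite ltnS.
by have := nsk (Ordinal iS); rewrite /= si.
Qed.

End GeneratingFunctions.

(** * Triples (A, B, v) and the submodules they generate *)

Lemma invmxM (R : comUnitRingType) n (g h : 'M[R]_n) : g \in unitmx -> h \in unitmx ->
  invmx (g *m h) = invmx h *m invmx g.
Proof.
move=> gu hu; have ghu : g *m h \in unitmx by rewrite unitmx_mul gu.
by rewrite -[RHS](mulmxK ghu) mulmxA mulmxKV // mulVmx // mul1mx.
Qed.

Section Triples.
Variable F : finFieldType.

Definition triple n : finType := ('M[F]_n * 'M[F]_n * 'rV[F]_n)%type.

Definition unit_triples n : {set triple n} :=
  [set t | (t.1.1 \in unitmx) && (t.1.2 \in unitmx)].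

Definition unitmxs n : {set 'M[F]_n} := [set g in unitmx].

Section Generation.
Variable n : nat.
Implicit Types (t : triple n) (g h : 'M[F]_n).

Definition submod t m (W : 'M[F]_(m, n)) : bool :=
  [&& t.2 <= W, stablemx W t.1.1 & stablemx W t.1.2]%MS.

(** Every row space is that of a square matrix, so square [W] suffice; over a finite field this
    keeps the condition decidable. [generatesP] passes to all shapes. *)
Definition generates t m (U : 'M[F]_(m, n)) : bool :=
  submod t U && [forall W : 'M[F]_n, submod t W ==> (U <= W)%MS].

Definition cyclic_span t : 'M[F]_n := (\bigcap_(W | submod t W) W)%MS.

(** Change of basis for row vectors, a right action of GL_n; it carries a submodule [W] to
    [W *m g]. *)
Definition conj_triple t g : triple n :=
  (invmx g *m t.1.1 *m g, invmx g *m t.1.2 *m g, t.2 *m g).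

Lemma eqmx_submod t m p (U : 'M[F]_(m, n)) (W : 'M[F]_(p, n)) :
  (U :=: W)%MS -> submod t U = submod t W.
Proof.
move=> UW; rewrite /submod !UW.
by rewrite !(eqmxMr _ UW).
Qed.

Lemma generatesP t m (U : 'M[F]_(m, n)) :
  reflect (submod t U /\ forall p (W : 'M[F]_(p, n)), submod t W -> (U <= W)%MS)
          (generates t U).
Proof.
apply: (iffP andP) => -[tU H]; split=> //.
  move=> p W tW; rewrite -(genmxE W); apply: (implyP (forallP H _)).
  by rewrite (eqmx_submod _ (genmxE W)).
by apply/forallP => W; apply/implyP/H.
Qed.

Lemma generates_eqmx t m p (U : 'M[F]_(m, n)) (W : 'M[F]_(p, n)) :
  generates t U -> generates t W = (U == W)%MS.
Proof.
move=> /generatesP[tU HU]; apply/generatesP/idP => [[tW HW]|/eqmxP UW].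
  by rewrite HU ?HW.
by rewrite -(eqmx_submod _ UW); split=> // r V; rewrite -UW; apply: HU.
Qed.

Lemma generates_cyclic_span t : generates t (cyclic_span t).
Proof.
apply/generatesP; split=> [|p W tW]; last first.
  rewrite -(genmxE W); apply: (@bigcapmx_inf _ _ <<W>>%MS); rewrite ?submx_refl //.
  by rewrite (eqmx_submod _ (genmxE W)).
apply/and3P; split; apply/sub_bigcapmxP => W tW; have /and3P[vW AW BW] := tW => //.
  apply: submx_trans AW; apply: submxMr; exact: bigcapmx_inf tW _.
apply: submx_trans BW; apply: submxMr; exact: bigcapmx_inf tW _.
Qed.

Lemma submod_conj t g m (W : 'M[F]_(m, n)) : g \in unitmx ->
  submod (conj_triple t g) (W *m g) = submod t W.
Proof.
move=> gu; have E (X : 'M[F]_n) : W *m g *m (invmx g *m X *m g) = W *m X *m g.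
  by rewrite !mulmxA mulmxK.
by rewrite /submod /= !E !submxMfree // row_free_unit.
Qed.

Lemma conj_tripleK t g : g \in unitmx -> conj_triple (conj_triple t g) (invmx g) = t.
Proof.
move=> gu; have E (X : 'M[F]_n) : invmx (invmx g) *m (invmx g *m X *m g) *m invmx g = X.
  by rewrite invmxK !mulmxA mulmxV // mul1mx mulmxK.
by case: t => -[A B] v; rewrite /conj_triple /= !E mulmxK.
Qed.

Lemma conj_tripleM t g h : g \in unitmx -> h \in unitmx ->
  conj_triple (conj_triple t g) h = conj_triple t (g *m h).
Proof. by move=> gu hu; rewrite /conj_triple /= invmxM // !mulmxA. Qed.

Lemma generates_conj t g m (U : 'M[F]_(m, n)) : g \in unitmx ->
  generates (conj_triple t g) (U *m g) = generates t U.
Proof.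
have sub t' h (U' : 'M[F]_(m, n)) : h \in unitmx ->
    generates t' U' -> generates (conj_triple t' h) (U' *m h).
  move=> hu /generatesP[tU HU]; apply/generatesP; rewrite submod_conj //; split=> // p W.
  rewrite -{1}(mulmxKV hu W) submod_conj // => /HU.
  move=> le; rewrite -(mulmxKV hu W); exact: submxMr.
move=> gu; apply/idP/idP; last exact: sub.
by move/(@sub _ (invmx g)); rewrite unitmx_inv conj_tripleK // mulmxK //; apply.
Qed.

Lemma conj_unit_triples t g : g \in unitmx ->
  (conj_triple t g \in unit_triples n) = (t \in unit_triples n).
Proof.
by move=> gu; rewrite !inE /= !unitmx_mul !unitmx_inv gu !andbT.
Qed.

Definition cyclic_triples : {set triple n} :=
  [set t in unit_triples n | generates t (1%:M : 'M[F]_n)].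

Lemma conj_cyclic t g : g \in unitmx ->
  (conj_triple t g \in cyclic_triples) = (t \in cyclic_triples).
Proof.
move=> gu; rewrite [LHS]in_set [RHS]in_set conj_unit_triples //; congr andb.
rewrite -(generates_conj t _ gu) mul1mx.
apply/generatesP/generatesP => -[t1 H]; split.
- by apply/and3P; split; rewrite ?submx_full ?row_full_unit.
- by move=> p W /H; apply: submx_trans; rewrite submx1.
- by apply/and3P; split; rewrite ?submx1.
- by move=> p W /H; apply: submx_trans; rewrite submx_full ?row_full_unit.
Qed.

(* The kernel of g - h is a submodule of t, so it is everything. *)
Lemma conj_triple_inj t g h : generates t (1%:M : 'M[F]_n) ->
  g \in unitmx -> h \in unitmx -> conj_triple t g = conj_triple t h -> g = h.
Proof.
case: t => -[A B] v /generatesP[_ H] gu hu [EA EB Ev].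
have comm (X : 'M[F]_n) : invmx g *m X *m g = invmx h *m X *m h ->
    X *m (g - h) = (g - h) *m (invmx g *m X *m g).
  move=> E; rewrite mulmxBl {2}E mulmxBr !mulmxA !mulmxV // !mul1mx //.
suff: (1%:M <= kermx (g - h))%MS by move/sub_kermxP/eqP; rewrite mul1mx subr_eq0 => /eqP.
apply: H; apply/and3P; split; apply/sub_kermxP => /=.
- by rewrite mulmxBr Ev subrr.
- by rewrite -mulmxA comm // mulmxA mulmx_ker mul0mx.
- by rewrite -mulmxA comm // mulmxA mulmx_ker mul0mx.
Qed.

Definition same_orbit t t' := [exists g in unitmxs n, t' == conj_triple t g].

Lemma same_orbitP t t' :
  reflect (exists2 g, g \in unitmx & t' = conj_triple t g) (same_orbit t t').
Proof.
apply: (iffP exists_inP) => -[g + E].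
  by rewrite inE => gu; exists g; last exact/eqP.
by move=> gu; exists g; rewrite ?inE //; apply/eqP.
Qed.

Lemma same_orbit_equiv : {in cyclic_triples & &, equivalence_rel same_orbit}.
Proof.
move=> x y z _ _ _; split.
  apply/same_orbitP; exists 1%:M; rewrite ?unitmx1 //.
  by case: z => -[A B] v; rewrite /conj_triple /= invmx1 !mul1mx !mulmx1.
move=> /same_orbitP[g gu ->]; apply/same_orbitP/same_orbitP => -[h hu ->].
  exists (invmx g *m h); first by rewrite unitmx_mul unitmx_inv gu.
  by rewrite conj_tripleM // ?mulKVmx // unitmx_mul unitmx_inv gu.
by exists (g *m h); rewrite ?unitmx_mul ?gu // conj_tripleM.
Qed.

Definition cyclic_orbits := equivalence_partition same_orbit cyclic_triples.

(** GL_n acts freely on cyclic triples by [conj_triple_inj], so every orbit has |GL_n| elements. *)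
Lemma card_cyclic_triples : #|cyclic_triples| = (#|cyclic_orbits| * #|unitmxs n|)%N.
Proof.
apply: card_uniform_partition; last exact/equivalence_partitionP/same_orbit_equiv.
move=> _ /imsetP[t tc ->].
have -> : [set t' in cyclic_triples | same_orbit t t'] = conj_triple t @: unitmxs n.
  apply/setP => t'; rewrite inE; apply/andP/imsetP => [[_ /same_orbitP[g gu ->]]|].
    by exists g; rewrite ?inE.
  move=> [g]; rewrite inE => gu ->; rewrite conj_cyclic //; split=> //.
  by apply/same_orbitP; exists g.
apply: card_in_imset => g h; rewrite !inE => gu hu; apply: conj_triple_inj => //.
by move: tc; rewrite !inE => /andP[].
Qed.

End Generation.

End Triples.

(** * Counting triples by the dimension of the generated submodule *)

Section Flags.
Variables (F : finFieldType) (k l : nat).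

(** The span of the first [k] basis vectors serves as the model of a subspace of dimension [k]. *)
Definition top_rows : 'M[F]_(k, k + l) := row_mx 1%:M 0.

Lemma submx_top_rows m (X : 'M[F]_(m, k)) (Y : 'M[F]_(m, l)) :
  (row_mx X Y <= top_rows)%MS = (Y == 0).
Proof.
apply/submxP/eqP => [[D]|->].
  by rewrite mul_mx_row mulmx0 => /eq_row_mx[].
by exists X; rewrite mul_mx_row mulmx1 mulmx0.
Qed.

Lemma unitmx_lblock (g1 : 'M[F]_k) (g3 : 'M[F]_(l, k)) (g4 : 'M[F]_l) :
  (block_mx g1 0 g3 g4 \in unitmx) = (g1 \in unitmx) && (g4 \in unitmx).
Proof. by rewrite !unitmxE det_lblock unitrM. Qed.

(** The model subspace contains the vector and is stable exactly when the upper right blocks and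
    [v2] vanish; the submodules inside it are then those of [(A1, B1, v1)]. *)
Lemma generates_top_rows (A1 B1 : 'M[F]_k) (A2 B2 : 'M[F]_(k, l))
    (A3 B3 : 'M[F]_(l, k)) (A4 B4 : 'M[F]_l) (v1 : 'rV[F]_k) (v2 : 'rV[F]_l) :
  generates (block_mx A1 A2 A3 A4, block_mx B1 B2 B3 B4, row_mx v1 v2) top_rows =
  [&& A2 == 0, B2 == 0, v2 == 0 & generates (A1, B1, v1) (1%:M : 'M[F]_k)].
Proof.
set t := (_, _, _).
have submod_top m (W : 'M[F]_(m, k)) : A2 = 0 -> B2 = 0 -> v2 = 0 ->
    submod t (row_mx W (0 : 'M[F]_(m, l))) = submod (A1, B1, v1) W.
  have le p (X : 'M[F]_(p, k)) :
      (row_mx X (0 : 'M[F]_(p, l)) <= row_mx W (0 : 'M[F]_(m, l)))%MS = (X <= W)%MS.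
    apply/submxP/submxP => -[D E]; exists D.
      by move: E; rewrite mul_mx_row => /eq_row_mx[].
    by rewrite E mul_mx_row mulmx0.
  move=> A20 B20 v20; rewrite /submod /t /= A20 B20 v20 !mul_row_block !mulmx0 !mul0mx.
  by rewrite !addr0 !le.
apply/idP/and4P => [/generatesP[/and3P[/= vt At Bt] H]|[/eqP A20 /eqP B20 /eqP v20]].
  move: vt At Bt; rewrite submx_top_rows /top_rows !mul_row_block.
  rewrite !mul0mx !mul1mx !addr0 !submx_top_rows => v20 A20 B20; split=> //.
  move: v20 A20 B20 => /eqP v20 /eqP A20 /eqP B20.
  apply/generatesP; split; first by apply/and3P; split; apply: submx1.
  move=> p W; rewrite -submod_top // => /H /submxP[D].
  by rewrite mul_mx_row => /eq_row_mx[-> _]; apply: submxMl.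
move=> /generatesP[_ H]; apply/generatesP; split.
  by rewrite submod_top //; apply/and3P; split; apply: submx1.
(* Cutting [W] down to the model subspace yields a submodule of [(A1, B1, v1)], which is
   everything. *)
move=> p W /and3P[vW AW BW]; pose W' := (W :&: top_rows)%MS.
have W'E : W' = row_mx (lsubmx W') 0.
  have : (W' <= top_rows)%MS by apply: capmxSr.
  by rewrite -{1}[W']hsubmxK submx_top_rows => /eqP <-; rewrite hsubmxK.
have /H/submxP[D E] : submod (A1, B1, v1) (lsubmx W').
  rewrite -submod_top // -W'E /submod /t /= !sub_capmx vW /= v20 submx_top_rows eqxx /=.
  have le (X : 'M[F]_(k + l)) : (W *m X <= W)%MS -> (W' *m X <= W)%MS.
    by apply: submx_trans; apply/submxMr/capmxSl.
  rewrite !le //= W'E !mul_row_block A20 B20 !mulmx0 !mul0mx !addr0 !submx_top_rows.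
  by rewrite eqxx.
have -> : top_rows = D *m W' by rewrite W'E mul_mx_row -E mulmx0.
by rewrite (submx_trans (submxMl _ _)) ?capmxSl.
Qed.

(** The upper left blocks and [v1] form a cyclic triple, the lower right blocks are any invertible
    matrices, and the lower left ones are arbitrary. *)
Lemma card_generates_top_rows :
  #|[set t in unit_triples F (k + l) | generates t top_rows]| =
  (#|cyclic_triples F k| * (#|unitmxs F l| ^ 2 * (#|F| ^ (l * k)) ^ 2))%N.
Proof.
pose D := setX (cyclic_triples F k) (setX (setX (unitmxs F l) (unitmxs F l))
  [set: 'M[F]_(l, k) * 'M[F]_(l, k)]).
pose f (x : triple F k * (('M[F]_l * 'M[F]_l) * ('M[F]_(l, k) * 'M[F]_(l, k)))) :
    triple F (k + l) :=
  (block_mx x.1.1.1 0 x.2.2.1 x.2.1.1, block_mx x.1.1.2 0 x.2.2.2 x.2.1.2, row_mx x.1.2 0).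
transitivity #|f @: D|.
  congr #|pred_of_set _|; apply/setP => t; rewrite in_set.
  apply/andP/imsetP => [|[[[[A1 B1] v1] [[A4 B4] [A3 B3]]]]].
    case: t => -[A B] v; rewrite -(submxK A) -(submxK B) -(hsubmxK v) => -[tu].
    rewrite generates_top_rows => /and4P[/eqP A20 /eqP B20 /eqP v20 tg].
    exists ((ulsubmx A, ulsubmx B, lsubmx v),
       ((drsubmx A, drsubmx B), (dlsubmx A, dlsubmx B))); last first.
      by rewrite /f /= A20 B20 v20.
    move: tu; rewrite A20 B20 inE /= !unitmx_lblock => /andP[/andP[a1 a4] /andP[b1 b4]].
    by rewrite !inE /= tg a1 a4 b1 b4.
  rewrite !inE /= => /andP[/andP[/andP[? ?] g1] /andP[/andP[? ?] _]] -> /=.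
  rewrite generates_top_rows !eqxx /= g1 !unitmx_lblock; split=> //.
  by apply/andP; split; apply/andP.
rewrite card_in_imset
  => [|[[[A1 B1] v1] [[A4 B4] [A3 B3]]] [[[C1 D1] w1] [[C4 D4] [C3 D3]]] _ _].
  by rewrite !cardsX cardsT card_prod card_mx !mulnn.
by case=> /eq_block_mx[-> _ -> ->] /eq_block_mx[-> _ -> ->] /eq_row_mx[-> _].
Qed.

(** These matrices form the stabilizer of the model subspace: block lower triangular with invertible
    diagonal blocks. *)
Lemma card_top_rows :
  #|[set g in unitmxs F (k + l) | (usubmx g == top_rows)%MS]| =
  (#|unitmxs F k| * #|unitmxs F l| * #|F| ^ (l * k))%N.
Proof.
have usub_block (g1 : 'M[F]_k) g2 (g3 : 'M_(l, k)) (g4 : 'M_l) :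
    usubmx (block_mx g1 g2 g3 g4) = row_mx g1 g2 by rewrite block_mxEv col_mxKu.
pose D := setX (setX (unitmxs F k) (unitmxs F l)) [set: 'M[F]_(l, k)].
pose f (x : ('M[F]_k * 'M[F]_l) * 'M[F]_(l, k)) : 'M[F]_(k + l) :=
  block_mx x.1.1 0 x.2 x.1.2.
transitivity #|f @: D|.
  congr #|pred_of_set _|; apply/setP => g; rewrite !inE.
  apply/andP/imsetP => [|[[[g1 g4] g3]]].
    rewrite -(submxK g); move: (ulsubmx g) (ursubmx g) (dlsubmx g) (drsubmx g).
    move=> g1 g2 g3 g4; rewrite usub_block submx_top_rows.
    move=> [+ /andP[/eqP g20 _]]; rewrite g20 unitmx_lblock => /andP[g1u g4u].
    by exists ((g1, g4), g3); rewrite ?inE //= g1u g4u.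
  rewrite !inE /= => /andP[/andP[g1u g4u] _] -> /=.
  rewrite unitmx_lblock g1u g4u; split=> //; rewrite usub_block submx_top_rows eqxx.
  by apply/submxP; exists (invmx g1); rewrite mul_mx_row mulVmx // mulmx0.
rewrite card_in_imset => [|[[g1 g4] g3] [[h1 h4] h3] _ _].
  by rewrite !cardsX cardsT card_mx.
by move/eq_block_mx=> /= [-> _ -> ->].
Qed.

(** The general linear group is transitive on subspaces of dimension [k], so right translation by
    some [g0] reduces [U] to the model subspace. *)
Lemma card_usubmx (U : 'M[F]_(k + l)) : \rank U = k ->
  #|[set g in unitmxs F (k + l) | (usubmx g == U)%MS]| =
  (#|unitmxs F k| * #|unitmxs F l| * #|F| ^ (l * k))%N.
Proof.
move=> rU; have [g0 g0u UE] : exists2 g0 : 'M[F]_(k + l),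
    g0 \in unitmx & (U :=: top_rows *m g0)%MS.
  (* In the rank factorization of [U] the invertible left factor does not affect the row space, and
     the middle factor has the row space of [top_rows]. *)
  exists (row_ebase U); first exact: row_ebase_unit.
  rewrite -{1}(mulmx_ebase U) rU -mulmxA.
  apply: eqmx_trans (eqmxMfull _ _) _; first by rewrite row_full_unit col_ebase_unit.
  apply: eqmxMr; rewrite pid_mx_block block_mxEv row_mx0.
  apply/eqmxP/andP; split; first by rewrite col_mx_sub sub0mx submx_refl.
  by apply/submxP; exists (row_mx 1%:M 0); rewrite mul_row_col mul1mx mul0mx addr0.
have inj : injective (fun g : 'M[F]_(k + l) => g *m g0).
  by move=> g h E; rewrite -(mulmxK g0u g) E mulmxK.
rewrite -card_top_rows -[RHS](card_imset _ inj); congr #|pred_of_set _|.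
have E h : usubmx (h *m g0) = usubmx h *m g0.
  by rewrite -{1}(vsubmxK h) mul_col_mx col_mxKu.
have free : row_free g0 by rewrite row_free_unit.
have le h : (usubmx (h *m g0) == U)%MS = (usubmx h == top_rows)%MS.
  by rewrite E !UE !submxMfree.
apply/setP => g; rewrite [LHS]in_set; apply/andP/imsetP => [[gu gU]|[h + ->]].
  exists (g *m invmx g0); last by rewrite mulmxKV.
  rewrite in_set -le mulmxKV // gU andbT.
  by move: gu; rewrite !in_set unitmx_mul unitmx_inv g0u andbT.
by rewrite !in_set le unitmx_mul g0u andbT => /andP.
Qed.

(* Both sides, multiplied by |GL_l| q^(lk), count the pairs (t, g) such that the
   first k rows of g span the submodule generated by t. *)
Lemma card_rank_cyclic_span :
  (#|[set t in unit_triples F (k + l) | \rank (cyclic_span t) == k]| * #|unitmxs F k| =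
   #|unitmxs F (k + l)| * #|cyclic_triples F k| * #|unitmxs F l| * #|F| ^ (l * k))%N.
Proof.
set T := [set t in _ | _].
have gl0 : (0 < #|unitmxs F l|)%N by apply/card_gt0P; exists 1%:M; rewrite inE unitmx1.
have q0 : (0 < #|F| ^ (l * k))%N
  by rewrite expn_gt0 (_ : 0 < #|F|)%N //; apply/card_gt0P; exists 0.
apply/eqP; rewrite -(eqn_pmul2r gl0) -(eqn_pmul2r q0); apply/eqP.
transitivity (\sum_(t in T) \sum_(g in unitmxs F (k + l) |
    (usubmx g == cyclic_span t)%MS) 1)%N.
  rewrite -!mulnA !(mulnA #|unitmxs F k|) -sum_nat_const; apply: eq_bigr => t.
  rewrite inE => /andP[_ /eqP rt]; rewrite -(card_usubmx rt) -sum1_card.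
  by apply: eq_bigl => g; rewrite inE.
rewrite (exchange_big_dep (mem (unitmxs F (k + l)))) /=; last by move=> t g _ /andP[].
rewrite -!mulnA -sum_nat_const; apply: eq_bigr => g.
rewrite in_set => gu.
have gE : usubmx g = top_rows *m g.
  by rewrite -{2}(vsubmxK g) mul_row_col mul1mx mul0mx addr0.
(* For fixed [g], conjugation by [g] matches the triples generating [top_rows] with those generating
   the span of the first [k] rows of [g], so the count does not depend on [g]. *)
have inj : injective (fun t : triple F (k + l) => conj_triple t g).
  by move=> t t' E; rewrite -(conj_tripleK t gu) E conj_tripleK.
rewrite sum1_card; symmetry.
transitivity #|[set t in unit_triples F (k + l) | generates t top_rows]|.
  by rewrite card_generates_top_rows; ring.
rewrite -(card_imset _ inj) -sum1_card -[RHS]sum1_card; apply: eq_bigl => t.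
apply/imsetP/andP => [[t' + ->]|].
  rewrite in_set -(conj_unit_triples t' gu) -(generates_conj t' _ gu) -gE => /andP[tu tg].
  move: (generates_eqmx (cyclic_span (conj_triple t' g)) tg).
  rewrite generates_cyclic_span => /esym E; rewrite in_set tu gu E; split=> //=.
  rewrite -(eqmxP E) gE mxrankMfree ?row_free_unit //.
  by rewrite /top_rows -pid_mx_row rank_pid_mx ?leq_addr.
rewrite in_set gu => -[/andP[tu /eqP rt] /= E].
exists (conj_triple t (invmx g)); last first.
  by rewrite -{2}(invmxK g) conj_tripleK ?unitmx_inv.
have giu : invmx g \in unitmx by rewrite unitmx_inv.
rewrite in_set conj_unit_triples // tu -(mulmxK gu top_rows) generates_conj // -gE.
by rewrite (generates_eqmx _ (generates_cyclic_span t)); case/andP: E => -> ->.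
Qed.

End Flags.

(** * The recurrence for the number of orbits and its solution *)

Section Counting.
Variable F : finFieldType.

Lemma card_unitmxs_gt0 n : (0 < #|unitmxs F n|)%N.
Proof. by apply/card_gt0P; exists 1%:M; rewrite inE unitmx1. Qed.

Lemma card_unit_triples n : #|unit_triples F n| = (#|unitmxs F n| ^ 2 * #|F| ^ n)%N.
Proof.
have -> : unit_triples F n = setX (setX (unitmxs F n) (unitmxs F n)) [set: 'rV[F]_n].
  by apply/setP => -[[A B] v]; rewrite !inE andbT.
by rewrite !cardsX cardsT card_mx mulnn mul1n.
Qed.

Lemma sum_cyclic_orbits n :
  (\sum_(k < n.+1) #|cyclic_orbits F k| * #|unitmxs F (n - k)| * #|F| ^ (k * (n - k)) =
   #|unitmxs F n| * #|F| ^ n)%N.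
Proof.
have g0 := card_unitmxs_gt0 n; apply/eqP; rewrite -(eqn_pmul2l g0); apply/eqP.
rewrite mulnA mulnn -card_unit_triples big_distrr /= -[RHS]sum1_card.
(* The rank is at most [n], so [inord] does not alter it. *)
pose f (t : triple F n) : 'I_n.+1 := inord (\rank (cyclic_span t)).
rewrite (partition_big f xpredT) //=; apply: eq_bigr => k _.
have kn : (k + (n - k) = n)%N by rewrite subnKC // -ltnS.
(* Multiplying by |GL_k|, the number of cyclic triples per orbit, gives the form of
   [card_rank_cyclic_span]. *)
apply/eqP; rewrite -(eqn_pmul2r (card_unitmxs_gt0 k)); apply/eqP.
have := card_rank_cyclic_span F k (n - k); rewrite kn card_cyclic_triples.
have -> : #|[set t in unit_triples F n | \rank (cyclic_span t) == k]| =
    (\sum_(t in unit_triples F n | f t == k) 1)%N.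
  rewrite -sum1_card; apply: eq_bigl => t; rewrite in_set /f -val_eqE /= inordK //.
  by rewrite ltnS rank_leq_row.
by move=> ->; rewrite [((n - k) * k)%N]mulnC; ring.
Qed.

(** The order of GL_n is q^C(n, 2) times the product of the q^i - 1 for 1 <= i <= n; each of these
    is q - 1 times the factor that [inv_gfS] contributes. *)
Lemma card_unitmxs (R : comNzRingType) n : let q : R := #|F|%:R in
  #|unitmxs F n|%:R = (q - 1) ^+ n * q ^+ 'C(n, 2) * inv_gf q n.
Proof.
move=> q; case: n => [|n].
  rewrite inv_gf0 !mul1r; suff -> : unitmxs F 0 = [set 1%:M] by rewrite cards1.
  by apply/setP => A; rewrite !inE [A]thinmx0 [1%:M]thinmx0 eqxx unitmxE det_mx00 unitr1.
have -> : #|unitmxs F n.+1| = #|'GL_n.+1[F]%g|.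
  rewrite -[RHS](card_imset _ val_inj); apply: eq_card => A.
  rewrite !inE; apply/idP/imsetP => [Au|[[B Bu] _ ->]] //.
  by exists (Sub A Au).
rewrite card_GL // natrM natrX mulrAC mulrC; congr (_ * _).
elim: n.+1 => [|m IHm]; first by rewrite big_nil inv_gf0 mulr1.
rewrite big_nat_recr //= natrM {}IHm inv_gfS exprS natrB ?expn_gt0; last first.
  by apply/orP/or_introl/card_gt0P; exists 0.
by rewrite natrX -/q subrX1; ring.
Qed.

Lemma card_cyclic_orbits n : (0 < n)%N -> let q : rat := #|F|%:R in
  q * #|cyclic_orbits F n|%:R = (q - 1) ^+ n.+1 * q ^+ 'C(n, 2) * indec_gf q n.+1.
Proof.
(* [M k] is the value to be established for [q * N k] when 0 < k. *)
move=> n0 q; pose M k : rat := (q - 1) ^+ k.+1 * q ^+ 'C(k, 2) * indec_gf q k.+1.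
pose N k : rat := #|cyclic_orbits F k|%:R; pose G k : rat := #|unitmxs F k|%:R.
have G0 k : G k != 0 by rewrite pnatr_eq0 -lt0n card_unitmxs_gt0.
have bin2 k l : 'C(k + l, 2) = ('C(k, 2) + 'C(l, 2) + k * l)%N.
  elim: k => [|k IHk]; first by rewrite bin0n mul0n addn0.
  by rewrite addSn !binS !bin1 IHk; ring.
have sumN m :
    \sum_(k < m.+1) q * N k * (G (m - k)%N * q ^+ (k * (m - k))) = G m * q ^+ m.+1.
  rewrite exprS mulrCA -natrX -natrM -sum_cyclic_orbits natr_sum mulr_sumr.
  by apply: eq_bigr => k _; rewrite !natrM natrX -/q -/(N _) -/(G _); ring.
(* This is [inv_gf_indec] times (q - 1)^(m+1) q^C(m, 2): [bin2] splits the exponent between the two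
   blocks, and (q - 1) times the factor in [inv_gfS] is q^(m+1) - 1. *)
have sumM m :
    \sum_(k < m.+1) M k * (G (m - k)%N * q ^+ (k * (m - k))) = G m * (q ^+ m.+1 - 1).
  transitivity ((q - 1) ^+ m.+1 * q ^+ 'C(m, 2) * inv_gf q m.+1).
    rewrite inv_gf_indec mulr_sumr; apply: eq_bigr => k _.
    rewrite /G card_unitmxs -/q /M.
    have km : (k <= m)%N by rewrite -ltnS.
    have -> : 'C(m, 2) = ('C(k, 2) + 'C(m - k, 2) + k * (m - k))%N by rewrite -bin2 subnKC.
    have -> : (q - 1) ^+ m.+1 = (q - 1) ^+ k.+1 * (q - 1) ^+ (m - k).
      by rewrite -exprD addSn subnKC.
    by rewrite !exprD; ring.
  by rewrite /G card_unitmxs -/q inv_gfS subrX1 exprS; ring.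
suff : q * N n - M n = 0 by move/eqP; rewrite subr_eq0 => /eqP.
have {}sumM m :
    \sum_(k < m.+1) (q * N k - M k) * (G (m - k)%N * q ^+ (k * (m - k))) = G m.
  under eq_bigr => k _ do rewrite mulrBl.
  by rewrite big_split /= sumrN sumN sumM; ring.
(* The case [m = 0] evaluates the discrepancy at k = 0. *)
have E0 : q * N 0%N - M 0%N = 1.
  have := sumM 0%N; rewrite big_ord1 subnn mul0n expr0 mulr1 => E.
  by apply: (mulIf (G0 0%N)); rewrite mul1r.
(* The term k = 0 already accounts for the whole right side. The intermediate terms vanish by
   induction, so the last one vanishes too. *)
elim/ltn_ind: n n0 => -[//|n] IHn _.
have := sumM n.+1; rewrite big_ord_recl E0 subn0 mul0n expr0 !mulr1 mul1r.
move=> /(canRL (addKr _)); rewrite addNr big_ord_recr /= big1 => [|k _].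
  rewrite add0r /bump /= add1n subnn muln0 expr0 mulr1 => /eqP.
  by rewrite mulf_eq0 (negPf (G0 _)) orbF => /eqP.
by rewrite IHn ?mul0r // /bump /= add1n ltnS.
Qed.

End Counting.

(** * Right ideals as annihilators of cyclic vectors *)

Section Codimension.
Local Open Scope quotient_scope.
Variables (K : fieldType) (V : lmodType K) (n : nat).

Lemma quotmod_eq (S : submodClosed V) (u v : V) :
  (\pi_(Quotient.quot (submod_pred S)) u = \pi_(Quotient.quot (submod_pred S)) v) <->
  u - v \in S.
Proof.
rewrite -[_ \in S]/(_ \in submod_pred S) Quotient.idealrBE; split=> [->|/eqP] //.
Qed.

Lemma quotmod_linear (S : submodClosed V) :
  linear (\pi_(Quotient.quot (submod_pred S)) : V -> quotmod S).
Proof.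
move=> a u v; rewrite raddfD; congr (_ + _).
apply/quotmod_eq; rewrite -scalerBr rpredZ //; apply/quotmod_eq.
by rewrite reprK.
Qed.

Section Kernel.
Variable f : {linear V -> 'rV[K]_n}.

Definition ker_pred : {pred V} := fun u => f u == 0.

Fact ker_pred_closed : subsemimod_closed ker_pred.
Proof.
have kerE u : (u \in ker_pred) = (f u == 0) by [].
split=> [|a u]; last by rewrite !kerE => /eqP u0; rewrite linearZ /= u0 scaler0.
by split=> [|u v]; rewrite !kerE ?linear0 // linearD => /eqP-> /eqP->; rewrite addr0.
Qed.

HB.instance Definition _ := GRing.isSubmodClosed.Build K V ker_pred ker_pred_closed.

(** [f] induces a linear map on the quotient by its kernel; chosen preimages under [f] provide the
    inverse. *)
Lemma has_codim_ker : (forall u, exists x, f x = u) ->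
  has_codim [set x | f x = 0]%classic n.
Proof.
move=> fsurj; exists (ker_pred : submodClosed V).
  by apply/seteqP; split=> x /= /eqP.
pose Q := Quotient.quot (submod_pred ker_pred).
have f_repr (x : V) : f (generic_quotient.repr (\pi_Q x)) = f x.
  apply/eqP; rewrite -subr_eq0 -linearB; apply/(quotmod_eq ker_pred).
  by rewrite generic_quotient.reprK.
pose g (u : quotmod ker_pred) : 'rV[K]_n := f (generic_quotient.repr (u : Q)).
have g_pi x : g (\pi_Q x) = f x by apply: f_repr.
have piK (u : Q) : \pi_Q (generic_quotient.repr u) = u by apply: reprK.
constructor; exists g => [a u v|].
  have := quotmod_linear ker_pred a (generic_quotient.repr (u : Q))
    (generic_quotient.repr (v : Q)).
  by rewrite -/Q !piK => <-; rewrite g_pi linearP.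
have [s sK] := choice fsurj.
exists (fun u => \pi_Q (s u)) => [u|u]; last by rewrite g_pi.
rewrite -[RHS](piK u); apply/quotmod_eq.
by rewrite -[_ \in _]/(f _ == 0) linearB subr_eq0 sK.
Qed.

End Kernel.

(** Coordinates on the quotient, composed with the projection, give a surjection with kernel [I]. *)
Lemma has_codimP (I : set V) : has_codim I n ->
  exists2 f : {linear V -> 'rV[K]_n},
    (forall u, exists x, f x = u) & I = [set x | f x = 0]%classic.
Proof.
move=> [S -> [[g glin [h hK gK]]]].
pose Q := Quotient.quot (submod_pred S).
pose f x := g (\pi_Q x).
have flin : linear f.
  move=> a x y; rewrite /f -glin; congr g; exact: quotmod_linear.
pose fM := GRing.isLinear.Build _ _ _ _ f flin.
pose fL : {linear V -> 'rV[K]_n} := HB.pack f fM.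
exists fL => [u|].
  by exists (generic_quotient.repr (h u : Q)); rewrite /= /f reprK gK.
have gpi0 : g (\pi_Q 0) = 0 by rewrite -[LHS]/(fL 0) linear0.
apply/seteqP; split=> x /=.
  move=> xS; rewrite /f -gpi0; congr g; apply/quotmod_eq.
  by rewrite subr0.
by rewrite /f -gpi0 => /(can_inj hK) /quotmod_eq; rewrite subr0.
Qed.

End Codimension.

(** The rows of the matrix are the values of [h] at chosen preimages of the basis vectors. *)
Lemma factor_linear (K : fieldType) (V : lmodType K) n p (f : {linear V -> 'rV[K]_n})
    (h : {linear V -> 'rV[K]_p}) :
  (forall u, exists x, f x = u) -> (forall x, f x = 0 -> h x = 0) ->
  exists g : 'M[K]_(n, p), forall x, h x = f x *m g.
Proof.
move=> /choice[s sK] fh.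
exists (\matrix_i h (s (delta_mx 0 i))) => x.
(* [y] is a preimage of [f x] built from the chosen ones, so [x - y] lies in the kernel of [f],
   hence in that of [h]. *)
pose y := \sum_i f x 0 i *: s (delta_mx 0 i).
have hy : h y = f x *m \matrix_i h (s (delta_mx 0 i)).
  rewrite mulmx_sum_row linear_sum; apply: eq_bigr => i _.
  by rewrite linearZ rowK.
rewrite -hy; apply/eqP; rewrite -subr_eq0 -linearB; apply/eqP/fh.
rewrite linearB linear_sum {1}[f x]row_sum_delta; apply/eqP; rewrite subr_eq0; apply/eqP.
by apply: eq_bigr => i _; rewrite linearZ /= sK.
Qed.

(** * The right module over the Laurent polynomials defined by a triple *)

Section Representation.
Variables (F : finFieldType) (n : nat).
Local Notation malgF := {malg F[free_group 'I_2]}.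
Implicit Types (t : triple F n) (u : 'rV[F]_n) (g h : free_group 'I_2).
Implicit Types (x y : laurent2 F) (c : 'I_2 * bool) (w : seq ('I_2 * bool)).

Definition letter t c : 'M[F]_n :=
  let A := if c.1 == 0 then t.1.1 else t.1.2 in if c.2 then invmx A else A.

Definition wordmx t w : 'M[F]_n := foldr (fun c M => letter t c *m M) 1%:M w.

(* The right action of x on the row vector u, a and b acting by t.1.1 and t.1.2. *)
Definition laurent_act t u x : 'rV[F]_n :=
  \sum_(g <- msupp (x : malgF))
    (x : malgF)@_g *: (u *m wordmx t g).

Definition gmon (g : free_group 'I_2) : laurent2 F := << 1 *g g >>.

Lemma letter_invl t c : t \in unit_triples F n -> letter t c *m letter t (invl c) = 1%:M.
Proof.
rewrite inE => /andP[Au Bu]; case: c => i b; rewrite /letter /=.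
by case: (i == 0); case: b; rewrite /= ?mulmxV ?mulVmx.
Qed.

Lemma wordmx_cat t w1 w2 : wordmx t (w1 ++ w2) = wordmx t w1 *m wordmx t w2.
Proof. by elim: w1 => [|c w1 IHw] /=; rewrite ?mul1mx // IHw mulmxA. Qed.

(** Cancelling adjacent inverse letters does not change the product; this makes [wordmx]
    multiplicative on the free group. *)
Lemma wordmx_reduce t w : t \in unit_triples F n -> wordmx t (reduce w) = wordmx t w.
Proof.
move=> tu; elim: w => //= c w <-; case: (reduce w) => //= d v; case: eqP => [->|] //.
by rewrite mulmxA letter_invl // mul1mx.
Qed.

Lemma wordmxM t g h : t \in unit_triples F n ->
  wordmx t (g * h)%g = wordmx t g *m wordmx t h.
Proof. by move=> tu; rewrite [LHS]wordmx_reduce // wordmx_cat. Qed.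

(** Enlarging the index set lets sums over different supports be compared termwise. *)
Lemma laurent_actw (d : {fset free_group 'I_2}) t u x :
  (msupp (x : malgF) `<=` d)%fset ->
  laurent_act t u x = \sum_(g <- d) (x : malgF)@_g *: (u *m wordmx t g).
Proof.
by move=> xd; apply: big_fset_incl => // g _ /mcoeff_outdom ->; rewrite scale0r.
Qed.

Lemma laurent_actD t u x y : laurent_act t u (x + y) = laurent_act t u x + laurent_act t u y.
Proof.
rewrite (laurent_actw _ _ (fsubsetUl (msupp x) (msupp y))).
rewrite (laurent_actw _ _ (fsubsetUr (msupp x) (msupp y))).
rewrite (laurent_actw _ _ (msuppD_le x y)) -big_split /=.
by apply: eq_bigr => g _; rewrite mcoeffD scalerDl.
Qed.

Lemma laurent_actZ t u a x : laurent_act t u (a *: x) = a *: laurent_act t u x.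
Proof.
rewrite (laurent_actw _ _ (msuppZ_le a x)) scaler_sumr.
by apply: eq_bigr => g _; rewrite mcoeffZ scalerA.
Qed.

Fact laurent_act_linear t u : linear (laurent_act t u).
Proof. by move=> a x y; rewrite laurent_actD laurent_actZ. Qed.

HB.instance Definition _ t u :=
  GRing.isLinear.Build F (laurent2 F) 'rV[F]_n _ (laurent_act t u) (laurent_act_linear t u).

Lemma laurent_act_gmon t u g : laurent_act t u (gmon g) = u *m wordmx t g.
Proof.
by rewrite (laurent_actw _ _ msuppU_le) big_seq_fset1 mcoeffUU scale1r.
Qed.

Lemma laurent_sum x : x = \sum_(g <- msupp (x : malgF))
    (x : malgF)@_g *: gmon g.
Proof.
rewrite [LHS](monalgE (x : malgF)); apply: eq_bigr => g _.
have := gaZE ((x : malgF)@_g) g g 1; rewrite mulr1 => E; exact: (esym E).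
Qed.

Lemma laurent_act0l t x : laurent_act t 0 x = 0.
Proof. by rewrite /laurent_act big1 // => g _; rewrite mul0mx scaler0. Qed.

Lemma gmonM g h : gmon g * gmon h = gmon (g * h)%g.
Proof. by rewrite [LHS]gamulUU mulr1. Qed.

(** Linearity in [x] and [y] reduces the claim to monomials, where it is [wordmxM]. *)
Lemma laurent_actM t u x y : t \in unit_triples F n ->
  laurent_act t u (x * y) = laurent_act t (laurent_act t u x) y.
Proof.
move=> tu; rewrite (laurent_sum y) mulr_sumr !linear_sum; apply: eq_bigr => h _.
rewrite -scalerAr !linearZ; congr (_ *: _).
rewrite (laurent_sum x) mulr_suml !linear_sum /= laurent_act_gmon mulmx_suml.
apply: eq_bigr => g _; rewrite -scalerAl !linearZ /= -scalemxAl; congr (_ *: _).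
by rewrite gmonM !laurent_act_gmon wordmxM // mulmxA.
Qed.

Lemma laurent_act1 t u : laurent_act t u 1 = u.
Proof. by rewrite -[1]/(gmon 1%g) laurent_act_gmon mulmx1. Qed.

Definition annihilator t : set (laurent2 F) := [set x | laurent_act t t.2 x = 0]%classic.

Lemma right_ideal_annihilator t : t \in unit_triples F n -> right_ideal (annihilator t).
Proof.
move=> tu; split; rewrite /annihilator /= ?linear0 // => x y.
  by rewrite laurent_actD => -> ->; rewrite addr0.
by rewrite laurent_actM // => ->; rewrite laurent_act0l.
Qed.

(** [A] preserves dimensions, so it maps the row space of [W] onto itself. *)
Lemma stablemx_inv m (W : 'M[F]_(m, n)) A : A \in unitmx ->
  stablemx W A -> stablemx W (invmx A).
Proof.
move=> Au WA; have : (W *m A == W)%MS.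
  by rewrite -mxrank_leqif_eq // mxrankMfree ?row_free_unit.
move=> /andP[_ H]; rewrite -[X in (_ <= X)%MS](mulmxK Au).
exact: submxMr.
Qed.

Lemma laurent_act_submod t m (W : 'M[F]_(m, n)) u x : t \in unit_triples F n ->
  submod t W -> (u <= W)%MS -> (laurent_act t u x <= W)%MS.
Proof.
rewrite inE => /andP[Au Bu] /and3P[_ WA WB] uW.
have WL c : stablemx W (letter t c).
  by rewrite /letter; case: ifP => _; case: ifP => _ //; apply: stablemx_inv.
rewrite /laurent_act; elim/big_rec: _ => [|g v _ IH]; first exact: sub0mx.
apply: addmx_sub => //; apply: scalemx_sub.
elim: {v IH}(word g) u uW => [|c w IHw] u uW /=; first by rewrite mulmx1.
by rewrite mulmxA IHw // (submx_trans (submxMr _ uW)).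
Qed.

(** The vectors obtained from [t.2] by the algebra form a submodule that lies in every submodule
    containing [t.2], so [t.2] generates the space exactly when they exhaust it. *)
Lemma cyclic_triplesP t : reflect
  (t \in unit_triples F n /\ forall u, exists x, laurent_act t t.2 x = u)
  (t \in cyclic_triples F n).
Proof.
rewrite [_ \in cyclic_triples _ _]in_set; apply: (iffP andP) => -[tu tc]; split=> //.
  pose P u := `[< exists x, laurent_act t t.2 x = u >].
  (* [W] is the span of the vectors reached from [t.2]; by [WP] these vectors already form a
     subspace. *)
  pose W := (\sum_(u : 'rV[F]_n | P u) genmx u)%MS.
  have WP u : (u <= W)%MS -> exists x, laurent_act t t.2 x = u.
    move=> /sub_sumsmxP[c ->]; have /choice[s sE] (v : 'rV[F]_n) :
        exists x, P v -> laurent_act t t.2 x = c v *m genmx v.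
      have /sub_rVP[a ->] : (c v *m genmx v <= v)%MS by rewrite -(genmxE v) submxMl.
      case: (boolP (P v)) => [/asboolP[x xv]|_]; last by exists 0.
      by exists (a *: x); rewrite linearZ /= xv.
    exists (\sum_(v | P v) s v).
    by rewrite linear_sum; apply: eq_bigr => v /sE.
  have PW x : (laurent_act t t.2 x <= W)%MS.
    apply: (sumsmx_sup (laurent_act t t.2 x)); last by rewrite genmxE.
    by apply/asboolP; exists x.
  have WS A g : wordmx t g = A -> stablemx W A.
    move=> gA; apply/rV_subP => u /submxP[D ->].
    rewrite mulmxA; have /WP[x <-] : (D *m W <= W)%MS by apply: submxMl.
    by rewrite -gA -laurent_act_gmon -laurent_actM.
  move=> u; apply: WP; move/generatesP: tc => [_ H].
  apply: submx_trans (submx1 _) (H _ W _); apply/and3P; split.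
  - by rewrite -[t.2](laurent_act1 t).
  - by apply: (WS _ (freeg_of [:: (0, false)])); rewrite /= mulmx1.
  - by apply: (WS _ (freeg_of [:: (1, false)])); rewrite /= mulmx1.
apply/generatesP; split; first by apply/and3P; split; apply: submx1.
move=> p W tW; apply/rV_subP => u _; have [x <-] := tc u.
by apply: laurent_act_submod => //; case/and3P: tW.
Qed.

End Representation.

(** * Right ideals of codimension n correspond to orbits of cyclic triples *)

Section Classification.
Variables (F : finFieldType) (n : nat).
Implicit Types (t : triple F n) (g h : free_group 'I_2) (x y : laurent2 F).

Definition gen (c : 'I_2 * bool) : free_group 'I_2 := freeg_of [:: c].

Lemma gmon1 : gmon F 1%g = 1.
Proof. by []. Qed.

Lemma freeg_of_cons c w : freeg_of (c :: w) = (gen c * freeg_of w)%g.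
Proof. by apply: val_inj; rewrite /= (reduce_id (reduced_reduce w)). Qed.

Lemma freeg_of_word g : freeg_of (word g) = g.
Proof. by apply: val_inj; rewrite /= reduce_id ?word_reduced. Qed.

Lemma genV c : (gen c * gen (invl c))%g = 1%g.
Proof. by rewrite -freeg_of_cons; apply: val_inj; rewrite /= eqxx. Qed.

Lemma annihilator_codim t : t \in cyclic_triples F n ->
  right_ideals_codim (laurent2 F) n (annihilator t).
Proof.
move=> /cyclic_triplesP[tu tsurj]; split; first exact: right_ideal_annihilator.
exact: has_codim_ker.
Qed.

Lemma letter_conj t (p : 'M[F]_n) c : t \in unit_triples F n -> p \in unitmx ->
  letter (conj_triple t p) c = invmx p *m letter t c *m p.
Proof.
rewrite inE => /andP[Au Bu] pu; rewrite /letter /=.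
have inv_conj A : A \in unitmx -> invmx (invmx p *m A *m p) = invmx p *m invmx A *m p.
  by move=> Au'; rewrite !invmxM ?unitmx_mul ?unitmx_inv ?pu // invmxK mulmxA.
by case: (c.1 == 0); case: c.2; rewrite // inv_conj.
Qed.

Lemma laurent_act_conj t (p : 'M[F]_n) x : t \in unit_triples F n -> p \in unitmx ->
  laurent_act (conj_triple t p) (conj_triple t p).2 x = laurent_act t t.2 x *m p.
Proof.
move=> tu pu; rewrite /laurent_act mulmx_suml; apply: eq_bigr => g _.
rewrite -scalemxAl; congr (_ *: _); rewrite -!mulmxA; congr (_ *m _).
elim: (word g) => [|c w IHw] /=; first by rewrite mulmx1 mul1mx.
by rewrite letter_conj // -!mulmxA IHw mulKVmx.
Qed.

(** A cyclic module is the algebra modulo the annihilator of its generator, so equal annihilators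
    give an isomorphism matching the generators. *)
Lemma same_orbit_annihilator t t' : t \in cyclic_triples F n -> t' \in cyclic_triples F n ->
  same_orbit t t' <-> annihilator t = annihilator t'.
Proof.
move=> /cyclic_triplesP[tu ts] /cyclic_triplesP[t'u t's]; split.
  move=> /same_orbitP[p pu ->]; apply/seteqP; rewrite /annihilator.
  split=> x /=; rewrite laurent_act_conj //; first by move=> ->; rewrite mul0mx.
  by move=> E; rewrite -[LHS](mulmxK pu) E mul0mx.
move=> E; have [p pE] : exists p, forall x, laurent_act t' t'.2 x = laurent_act t t.2 x *m p.
  apply: factor_linear ts _ => x x0; have : annihilator t x by [].
  by rewrite E.
have [r rE] : exists r, forall x, laurent_act t t.2 x = laurent_act t' t'.2 x *m r.
  apply: factor_linear t's _ => x x0; have : annihilator t' x by [].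
  by rewrite -E.
(* [p] and [r] exchange the images of each [x] in the two modules, and these images fill the space,
   so they are mutually inverse. *)
have pu : p \in unitmx.
  have : p *m r = 1%:M.
    apply/row_matrixP => i; rewrite !rowE mulmxA; have [x <-] := ts (delta_mx 0 i).
    by rewrite -pE -rE mulmx1.
  by case/mulmx1_unit.
have conjE c : letter t' c = invmx p *m letter t c *m p.
  suff comm : p *m letter t' c = letter t c *m p by rewrite -mulmxA -comm mulKmx.
  apply/row_matrixP => i; rewrite !rowE !mulmxA; have [x <-] := ts (delta_mx 0 i).
  have gE s : laurent_act s s.2 x *m letter s c =
      laurent_act s (laurent_act s s.2 x) (gmon F (gen c)).
    by rewrite laurent_act_gmon /= mulmx1.
  by rewrite -pE !gE -!laurent_actM // pE.
apply/same_orbitP; exists p => //.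
have A0 : t'.1.1 = invmx p *m t.1.1 *m p by have := conjE (0, false).
have B0 : t'.1.2 = invmx p *m t.1.2 *m p by have := conjE (1, false).
have v0 := pE 1; rewrite !laurent_act1 in v0.
by rewrite /conj_triple -A0 -B0 -v0; case: (t') => -[].
Qed.

(** Coordinates on the quotient by [I] turn right multiplication by a and b into two matrices and
    the class of 1 into a cyclic vector. *)
Lemma right_ideal_codim_annihilator (I : set (laurent2 F)) :
  right_ideals_codim (laurent2 F) n I ->
  exists2 t, t \in cyclic_triples F n & I = annihilator t.
Proof.
move=> [[_ _ IM] /has_codimP[f fsurj IE]].
(* Since [I] is a right ideal, multiplication by [y] preserves the kernel of [f] and descends to a
   matrix [r y]. *)
have /choice[r rE] (y : laurent2 F) : exists p : 'M[F]_n, forall x, f (x * y) = f x *m p.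
  pose h x := f (x * y).
  have hlin : linear h by move=> a x z; rewrite /h mulrDl -scalerAl linearP.
  pose hM := GRing.isLinear.Build _ _ _ _ h hlin.
  pose hL : {linear laurent2 F -> 'rV[F]_n} := HB.pack h hM.
  have [p pE] : exists p, forall x, hL x = f x *m p; last by exists p.
  apply: factor_linear fsurj _ => x x0; have : I x by rewrite IE.
  by move=> /(IM _ y); rewrite IE.
have rM y z : r (y * z) = r y *m r z.
  apply/row_matrixP => i; rewrite !rowE mulmxA; have [x <-] := fsurj (delta_mx 0 i).
  by rewrite -!rE mulrA.
have r1 : r 1 = 1%:M.
  apply/row_matrixP => i; rewrite !rowE; have [x <-] := fsurj (delta_mx 0 i).
  by rewrite -rE mulr1 mulmx1.
have [a aE] : exists a, forall c, r (gmon F (gen c)) = a c by eexists.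
have aV c : a c *m a (invl c) = 1%:M by rewrite -!aE -rM gmonM genV gmon1.
have au c : a c \in unitmx by have /mulmx1_unit[] := aV c.
pose t : triple F n := (a (0, false), a (1, false), f 1).
have tu : t \in unit_triples F n by rewrite inE /= !au.
have letE c : letter t c = a c.
  have E0 i : letter t (i, false) = a (i, false).
    rewrite /letter /=; case: eqVneq => [-> //|].
    by case: i => -[|[|//]] // i _; congr (a (_, _)); apply: val_inj.
  (* The matrix of an inverse letter is determined by its product with the matrix of the letter. *)
  case: c => i [] //; apply: (can_inj (mulmxK (au (i, false)))).
  by rewrite (aV (i, true)) -(letter_invl (i, true) tu) -[in LHS](E0 i).
have wE w : wordmx t w = r (gmon F (freeg_of w)).
  elim: w => [|c w IHw] /=; first by rewrite -r1.
  by rewrite IHw letE freeg_of_cons -gmonM rM aE.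
have fE x : f x = laurent_act t t.2 x.
  rewrite {1}(laurent_sum x) linear_sum /laurent_act; apply: eq_bigr => g _.
  by rewrite linearZ /= -[gmon F g]mul1r rE wE freeg_of_word.
exists t; last by rewrite IE; apply/seteqP; split=> x /=; rewrite fE.
by apply/cyclic_triplesP; split=> // u; have [x <-] := fsurj u; exists x.
Qed.

Lemma card_right_ideals_codim :
  (right_ideals_codim (laurent2 F) n #= `I_#|cyclic_orbits F n|)%card.
Proof.
pose O := cyclic_orbits F n.
have Opart : partition O (cyclic_triples F n).
  exact/equivalence_partitionP/same_orbit_equiv.
(* The default triple occurs only for an empty block, which a partition excludes. *)
pose rep (C : {set triple F n}) : triple F n := odflt (0, 0, 0) [pick t in C].
have repP C : C \in O -> rep C \in C.
  move=> CO; rewrite /rep; case: pickP => //= C0.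
  case/and3P: Opart => _ _ /negP[]; rewrite -(_ : C = set0) //.
  by apply/setP => t; rewrite C0 inE.
have repc C : C \in O -> rep C \in cyclic_triples F n.
  move=> CO; rewrite -(cover_partition Opart); apply/bigcupP; exists C => //; exact: repP.
have /and3P[_ Otriv _] := Opart.
have repE C t : C \in O -> t \in cyclic_triples F n -> same_orbit (rep C) t = (t \in C).
  move=> CO tc; rewrite -(pblock_equivalence_partition (@same_orbit_equiv _ _)) ?repc //.
  by rewrite (def_pblock Otriv CO (repP C CO)).
pose f (i : 'I_#|O|) := annihilator (rep (enum_val i)).
have -> : right_ideals_codim (laurent2 F) n = (f @` classical_sets.setT)%classic.
  apply/seteqP; split=> [I|_ [i _ <-]]; last exact/annihilator_codim/repc/enum_valP.
  move=> /right_ideal_codim_annihilator[t tc ->].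
  have [C CO tC] : exists2 C, C \in O & t \in C.
    by apply/bigcupP; rewrite -/(cover O) (cover_partition Opart).
  exists (enum_rank_in CO C) => //; rewrite /f enum_rankK_in //.
  by apply/same_orbit_annihilator; rewrite ?repE ?repc.
rewrite (card_eqr card_II) inj_card_eq // => i j _ _ fij.
apply: enum_val_inj; have iO := enum_valP i; have jO := enum_valP j.
have : same_orbit (rep (enum_val i)) (rep (enum_val j)).
  by apply/same_orbit_annihilator => //; apply: repc.
rewrite repE ?repc // => /(def_pblock Otriv iO) <-.
by rewrite (def_pblock Otriv jO (repP _ jO)).
Qed.

End Classification.

(** * Both closed formulas, read off from the count of orbits *)

Theorem theorem1 (F : finFieldType) (n : nat) (hn : (0 < n)%N) :
  let q : rat := #|F|%:R in
  exists N : nat,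
    [/\ (right_ideals_codim (laurent2 F) n #= `I_N)%card,
        N%:R = (q - 1) ^+ n.+1
               * q ^ ((((n%:Z + 1) * (n%:Z - 2)) %/ 2)%Z)
               * \sum_(theta in Indec n.+1) q ^+ inversions theta
      & N%:R = ((q - 1) / q) ^+ n.+1
               * \sum_(theta in Indec n.+1) q ^+ pstat theta].
Proof.
move=> q; have q0 : q != 0 by rewrite pnatr_eq0 -lt0n; apply/card_gt0P; exists 0.
have NE := card_cyclic_orbits F hn; rewrite -/q /indec_gf in NE.
exists #|cyclic_orbits F n|; split; first exact: card_right_ideals_codim.
- apply: (mulfI q0); rewrite NE.
  (* The division is exact; for n = 1 the exponent is -1, so it is taken in the integers. *)
  have -> : (((n%:Z + 1) * (n%:Z - 2)) %/ 2)%Z = 'C(n, 2)%:Z - 1.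
    suff -> : (n%:Z + 1) * (n%:Z - 2) = ('C(n, 2)%:Z - 1) * 2 by rewrite mulzK.
    case: n hn {NE} => [//|m] _; have := mul_bin_diag m.+1 1; rewrite /= bin1.
    move/(congr1 Posz); rewrite !PoszM => E.
    have -> : ('C(m.+1, 2)%:Z - 1) * 2 = 2%:Z * 'C(m.+1, 2)%:Z - 2 by ring.
    by rewrite -E -addn1 PoszD; ring.
  rewrite expfzDr // -exprnP exprN1 !mulrA [q * _]mulrC -!mulrA; congr (_ * _).
  by rewrite mulrCA; congr (_ * _); rewrite mulVKf.
(* By [pstatE] the extra exponent is C(n+1, 2) = n + C(n, 2); against the denominator q^(n+1) it
   leaves C(n, 2) - 1, as in the first formula. *)
- have -> : \sum_(theta in Indec n.+1) q ^+ pstat theta =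
      q ^+ n * q ^+ 'C(n, 2) * \sum_(theta in Indec n.+1) q ^+ inversions theta.
    rewrite mulr_sumr; apply: eq_bigr => theta _.
    by rewrite pstatE binS bin1 !exprD [q ^+ n * _]mulrC.
  apply: (mulfI q0); rewrite NE expr_div_n !mulrA; congr (_ * _ * _).
  by rewrite [q ^+ n.+1]exprS; field; rewrite q0 expf_neq0.
Qed.
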